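(* For every index $\bm{k}$, the following identity holds in $\widehat{\mathcal{Q}}$: \[ \zeta_{\widehat{\mathcal{Q}}}^{BZ}(\bm{k})=(-q^{-\bm{p}})^{\mathrm{dep}(\bm{k})}\sum_{l\ge0}\left(\sum_{\substack{\bm{l}\in(\mathbb{Z}_{\ge0})^{\mathrm{dep}(\bm{k})}\\ \mathrm{wt}(\bm{l})=l}}\ \sum_{\bm{l}\oplus\bm{k}\preceq\bm{m}\preceq\bm{l}\oslash\bm{k}}\zeta_{\widehat{\mathcal{Q}}}^{SZ}(\bm{m})\right)([\bm{p}]q^{-\bm{p}})^l . \]
   Context: Indices. An index is a finite (possibly empty) tuple $\bm{k}=(k_1,\dots,k_r)$ of positive integers; $\mathrm{dep}(\bm{k})=r$ and $\mathrm{wt}(\bm{k})=k_1+\cdots+k_r$ (both $0$ for the empty index $\varnothing$); $\mathrm{wt}$ is also used for tuples of non-negative integers. Every function $F$ on indices is given the value $F(\varnothing)=1$. We write $\bm{l}\preceq\bm{k}$ if $\bm{l}$ is obtained from $\bm{k}$ by replacing some (possibly none) of the commas in $\bm{k}$ by plus signs. For an index $\bm{k}=(k_1,\dots,k_r)$ and a tuple $\bm{l}=(l_1,\dots,l_r)$ of non-negative integers, \[ \bm{l}\oplus\bm{k}=(l_1+k_1,\dots,l_r+k_r),\qquad \bm{l}\oslash\bm{k}=(l_1+1,\{1\}^{k_1-1},\dots,l_r+1,\{1\}^{k_r-1}), \] where $\{1\}^{a}$ means $1,\dots,1$ repeated $a$ times. The inner sum is over indices $\bm{m}$ with $\bm{l}\oplus\bm{k}\preceq\bm{m}$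 and $\bm{m}\preceq\bm{l}\oslash\bm{k}$. The ring $\widehat{\mathcal{Q}}$. Let $[m]=\frac{1-q^m}{1-q}$. For a prime $p$ and $n\ge1$ put $Z_{p,n}=\mathbb{Z}_{(p)}[q]/([p]^n)$, where $\mathbb{Z}_{(p)}$ is the localization of $\mathbb{Z}$ at $p$, and $\mathcal{Q}_n=\left(\prod_p Z_{p,n}\right)/\left(\bigoplus_p Z_{p,n}\right)$, with $p$ running over all primes. The $\mathbb{Q}[q]$-algebra $\widehat{\mathcal{Q}}=\varprojlim_n\mathcal{Q}_n$ is formed with respect to the natural projections. Its elements are written $((f_{p,n})_p)_n$ with $f_{p,n}\in Z_{p,n}$. Put $[\bm{p}]=(([p]\bmod[p]^n)_p)_n$. $\widehat{\mathcal{Q}}$ is complete for the $[\bm{p}]$-adic topology, and infinite sums are taken in this topology. Moreover $q^{-\bm{p}}:=\sum_{j\ge0}([\bm{p}](1-q))^j\in\widehat{\mathcal{Q}}$. Values. For $\bm{k}=(k_1,\dots,k_r)$ and $N\ge 0$, \[ \zeta_N^{BZ}(\bm{k})=\sum_{0<m_1<\cdots<m_r\le N}\prod_{j=1}^r\frac{q^{(k_j-1)m_j}}{[m_j]^{k_j}},\qquad \zeta_N^{SZ}(\bm{k})=\sum_{0<m_1<\cdots<m_r\le N}\prod_{j=1}^r\frac{q^{k_jm_j}}{[m_j]^{k_j}}, \] and $\zeta_{\widehat{\mathcal{Q}}}^{\bullet}(\bm{k})=((\zeta_{p-1}^{\bullet}(\bm{k})\bmod[p]^n)_p)_n\in\widehat{\mathcal{Q}}$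 for $\bullet\in\{BZ,SZ\}$ (for $0<m<p$, $[m]$ is invertible in $Z_{p,n}$). *)

(* Defs.v *)
From HB Require Import structures.
From mathcomp Require Import all_boot all_order all_algebra.
From mathcomp Require Import ring_quotient.
From mathcomp Require Import boolp classical_sets functions cardinality.
From mathcomp Require Import topology ring.

Set Implicit Arguments.
Unset Strict Implicit.
Unset Printing Implicit Defensive.

Import Order.TTheory GRing.Theory Num.Theory.
Local Open Scope ring_scope.
Local Open Scope classical_set_scope.
Local Open Scope quotient_scope.

Definition dprod (I : pointedType) (T : I -> comNzRingType) : Type :=
  forall i, T i.

Section DProd.
Variables (I : pointedType) (T : I -> comNzRingType).
Implicit Types f g h : dprod T.

HB.instance Definition _ := gen_eqMixin (dprod T).
HB.instance Definition _ := gen_choiceMixin (dprod T).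

Definition dprod_zero : dprod T := fun=> 0.
Definition dprod_opp f : dprod T := fun i => - f i.
Definition dprod_add f g : dprod T := fun i => f i + g i.
Definition dprod_one : dprod T := fun=> 1.
Definition dprod_mul f g : dprod T := fun i => f i * g i.

Fact dprod_addA : associative dprod_add.
Proof. by move=> f g h; apply/functional_extensionality_dep => i; exact: addrA. Qed.
Fact dprod_addC : commutative dprod_add.
Proof. by move=> f g; apply/functional_extensionality_dep => i; exact: addrC. Qed.
Fact dprod_add0 : left_id dprod_zero dprod_add.
Proof. by move=> f; apply/functional_extensionality_dep => i; exact: add0r. Qed.
Fact dprod_addN : left_inverse dprod_zero dprod_opp dprod_add.
Proof. by move=> f; apply/functional_extensionality_dep => i; exact: addNr. Qed.

HB.instance Definition _ := GRing.isZmodule.Build (dprod T)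
  dprod_addA dprod_addC dprod_add0 dprod_addN.

Fact dprod_mulA : associative dprod_mul.
Proof. by move=> f g h; apply/functional_extensionality_dep => i; exact: mulrA. Qed.
Fact dprod_mulC : commutative dprod_mul.
Proof. by move=> f g; apply/functional_extensionality_dep => i; exact: mulrC. Qed.
Fact dprod_mul1 : left_id dprod_one dprod_mul.
Proof. by move=> f; apply/functional_extensionality_dep => i; exact: mul1r. Qed.
Fact dprod_mulD : left_distributive dprod_mul +%R.
Proof. by move=> f g h; apply/functional_extensionality_dep => i; exact: mulrDl. Qed.
Fact dprod_one_neq0 : dprod_one != 0.
Proof.
by apply/eqP => /(congr1 (fun f : dprod T => f point)) /eqP; rewrite oner_eq0.
Qed.

HB.instance Definition _ := GRing.Zmodule_isComNzRing.Build (dprod T)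
  dprod_mulA dprod_mulC dprod_mul1 dprod_mulD dprod_one_neq0.

Definition dproj (i : I) (f : dprod T) : T i := f i.

Fact dproj_zmod_morphism i : zmod_morphism (dproj i).
Proof. by []. Qed.
HB.instance Definition _ i :=
  GRing.isZmodMorphism.Build (dprod T) (T i) (dproj i) (dproj_zmod_morphism i).
Fact dproj_monoid_morphism i : monoid_morphism (dproj i).
Proof. by []. Qed.
HB.instance Definition _ i :=
  GRing.isMonoidMorphism.Build (dprod T) (T i) (dproj i)
    (dproj_monoid_morphism i).

End DProd.

Section QuotMap.
Variables (R S : comNzRingType) (I : idealr R) (J : idealr S).
Variable f : {rmorphism R -> S}.

(* This is the morphism induced by f only under the hypothesis fIJ below. *)
Definition quot_map (x : {ideal_quot I}) : {ideal_quot J} :=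
  \pi_{ideal_quot J} (f (repr x)).

Hypothesis fIJ : forall x, x \in (I : pred R) -> f x \in (J : pred S).

Lemma quot_map_pi x : quot_map (\pi_{ideal_quot I} x) = \pi_{ideal_quot J} (f x).
Proof.
apply/eqP; rewrite /quot_map -Quotient.idealrBE -rmorphB fIJ //.
by rewrite Quotient.idealrBE reprK.
Qed.

Lemma quot_map_zmod_morphism : zmod_morphism quot_map.
Proof.
move=> x y; rewrite -[x]reprK -[y]reprK -rmorphB !quot_map_pi.
by rewrite -!rmorphB.
Qed.

Lemma quot_map_monoid_morphism : monoid_morphism quot_map.
Proof.
split=> [|x y]; first by rewrite -(rmorph1 \pi) quot_map_pi !rmorph1.
by rewrite -[x]reprK -[y]reprK -rmorphM !quot_map_pi -!rmorphM.
Qed.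

End QuotMap.

Definition primeN : Type := {p : nat | prime p}.
HB.instance Definition _ := Choice.on primeN.
HB.instance Definition _ := isPointed.Build primeN (exist _ 2%N isT).

Lemma primeNP (p : primeN) : prime (val p).
Proof. exact: valP. Qed.

(* Z_(p), as the subring of the rationals whose reduced denominator is prime
   to p. *)

Section Zloc.
Variable p : primeN.

Definition in_Zloc : pred rat := fun x => ~~ (val p %| `|denq x|)%N.

Lemma in_ZlocP (x : rat) (a b : int) :
  ~~ (val p %| `|b|)%N -> x * b%:~R = a%:~R -> in_Zloc x.
Proof.
move=> pb xba; apply: contra pb => pd.
have dvd : (denq x %| b)%Z.
  have : numq x * b = a * denq x.
    apply: (@intr_inj rat); rewrite !rmorphM /= -xba mulrAC numqE.
    by rewrite [x * _ * _]mulrAC.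
  move/(congr1 (fun z => (denq x %| z)%Z)).
  rewrite [RHS]dvdz_mull ?dvdzz //.
  by rewrite Gauss_dvdzr // coprimezE coprime_sym coprime_num_den.
exact: dvdn_trans pd dvd.
Qed.

Fact Zloc_subring : subring_closed in_Zloc.
Proof.
have pr := primeNP p.
have den x y : in_Zloc x -> in_Zloc y -> ~~ (val p %| `|(denq x * denq y)%R|)%N.
  by move=> hx hy; rewrite abszM Euclid_dvdM // negb_or; apply/andP.
split=> [|x y hx hy|x y hx hy].
- by rewrite unfold_in /in_Zloc dvdn1 neq_ltn prime_gt1 ?orbT.
- apply: (in_ZlocP (den _ _ hx hy) (a := numq x * denq y - numq y * denq x)).
  by rewrite rmorphB !rmorphM /= !numqE; ring.
- apply: (in_ZlocP (den _ _ hx hy) (a := numq x * numq y)).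
  by rewrite !rmorphM /= !numqE; ring.
Qed.

HB.instance Definition _ := GRing.isSubringClosed.Build rat in_Zloc Zloc_subring.

Record Zloc : Type := MkZloc { Zloc_val :> rat; _ : in_Zloc Zloc_val }.

HB.instance Definition _ := [isSub for Zloc_val].
HB.instance Definition _ := [Choice of Zloc by <:].
HB.instance Definition _ := [SubChoice_isSubComNzRing of Zloc by <:].

Lemma Zloc_p_nonunit (c : Zloc) : c * (val p)%:R != 1.
Proof.
apply/eqP => /(congr1 val); rewrite rmorphM rmorph_nat rmorph1 /= => cp.
have /negP[] := valP c; rewrite /in_Zloc /=.
suff -> : denq (val c) = numq (val c) * (val p)%:Z by rewrite abszM dvdn_mull.
apply: (@intr_inj rat); rewrite rmorphM /= numqE mulrAC.
by rewrite -[(val p)%:~R]/((val p)%:R) cp mul1r.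
Qed.

End Zloc.

(* The q-integer [m] = (1 - q^m) / (1 - q), in a form that makes sense in every
   ring. *)
Definition qint (R : pzSemiRingType) (q : R) (m : nat) : R := \sum_(i < m) q ^+ i.

Section Qint.
Variables (R : comNzRingType) (q : R).

Lemma qintS m : qint q m.+1 = 1 + q * qint q m.
Proof.
rewrite /qint big_ord_recl expr0 mulr_sumr; congr (_ + _).
by apply: eq_bigr => i _; rewrite -exprS.
Qed.

Lemma qintM a b : qint q (a * b) = qint q a * qint (q ^+ a) b.
Proof.
elim: b => [|b IHb]; first by rewrite muln0 /qint !big_ord0 mulr0.
rewrite mulnS addnC /qint big_split_ord /= -/(qint q (a * b)) IHb.
rewrite big_ord_recr /= mulrDr; congr (_ + _).
rewrite mulr_suml; apply: eq_bigr => i _.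
by rewrite -exprM -exprD addnC.
Qed.

Lemma qint1 m : qint (1 : R) m = m%:R.
Proof.
rewrite /qint (eq_bigr (fun=> 1)) => [|i _]; last by rewrite expr1n.
by rewrite sumr_const card_ord.
Qed.

Lemma qint_inv (p m n : nat) :
  prime p -> (0 < m < p)%N -> qint q p ^+ n = 0 -> exists y, y * qint q m = 1.
Proof.
move=> pr /andP[m0 mp] nil.
have cop : coprime m p.
  rewrite coprime_sym prime_coprime //; apply/negP => /dvdn_leq.
  by move/(_ m0); rewrite leqNgt mp.
have [a b eqab _] := egcdnP p m0.
have {}eqab : (m * a = (p * b).+1)%N.
  by rewrite mulnC eqab (eqP cop) addn1 mulnC.
set x := q * (qint q p * qint (q ^+ p) b).
have xn : x ^+ n = 0 by rewrite /x !exprMn nil mul0r mulr0.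
have qm : qint q m * qint (q ^+ m) a = 1 + x by rewrite -qintM eqab qintS qintM.
exists (qint (q ^+ m) a * \sum_(i < n) (- x) ^+ i).
rewrite mulrAC [_ * qint q m]mulrC qm.
rewrite -[LHS]opprK -mulNr opprD [X in X * _]addrC.
rewrite -subrX1 exprNn xn mulr0 sub0r opprK //.
Qed.

End Qint.

Lemma rmorph_qint (R S : comNzRingType) (f : {rmorphism R -> S}) q m :
  f (qint q m) = qint (f q) m.
Proof. by rewrite rmorph_sum; apply: eq_bigr => i _; rewrite rmorphXn. Qed.

(* The rings Z_{p,n} = Z_(p)[q] / ([p]^n) are needed for n >= 1 only; throughout
   the index n : nat stands for the exponent n.+1. *)

Section Zpn.
Variables (p : primeN) (n : nat).

Definition Zpn_ideal : pred {poly Zloc p} :=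
  fun f => `[< exists g, f = g * qint 'X (val p) ^+ n.+1 >].

Fact Zpn_ideal_closed : idealr_closed Zpn_ideal.
Proof.
split.
- by apply/asboolP; exists 0; rewrite mul0r.
- apply/asboolP => -[g /(congr1 (fun h => h.[1])) /eqP].
  rewrite hornerC hornerM horner_exp -/(horner_eval 1 (qint _ _)) rmorph_qint.
  rewrite [X in qint X]hornerX qint1 exprSr mulrA eq_sym => h.
  by have := Zloc_p_nonunit (g.[1] * (val p)%:R ^+ n); rewrite h.
- move=> a u v /asboolP[f ->] /asboolP[g ->]; apply/asboolP.
  by exists (a * f + g); rewrite mulrDl mulrA.
Qed.

HB.instance Definition _ := isIdealr.Build {poly Zloc p} Zpn_ideal Zpn_ideal_closed.

Definition Zpn_idealr : idealr {poly Zloc p} := Zpn_ideal.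

Definition Zpn : Type := {ideal_quot Zpn_idealr}.
HB.instance Definition _ := GRing.ComNzRing.on Zpn.

Definition Zpn_pi : {poly Zloc p} -> Zpn := \pi_{ideal_quot Zpn_idealr}.
HB.instance Definition _ := GRing.RMorphism.on Zpn_pi.

(* Units and inverses are the usual ones; as always in unitRingType, the inverse
   of a non-unit x is x. Only inverses of [m] for 0 < m < p are used, see
   qint_Zpn_unit. *)
Definition Zpn_unit : {pred Zpn} := fun x => `[< exists y, y * x = 1 >].
Definition Zpn_inv (x : Zpn) : Zpn :=
  if pselect (exists y, y * x = 1) is left h then projT1 (cid h) else x.

Fact Zpn_mulVx : {in Zpn_unit, left_inverse 1 Zpn_inv *%R}.
Proof.
by move=> x /asboolP ux; rewrite /Zpn_inv; case: pselect => // h; case: cid.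
Qed.
Fact Zpn_unitPl (x y : Zpn) : y * x = 1 -> Zpn_unit x.
Proof. by move=> yx; apply/asboolP; exists y. Qed.
Fact Zpn_invr_out : {in [predC Zpn_unit], Zpn_inv =1 id}.
Proof. by move=> x /asboolP ux; rewrite /Zpn_inv; case: pselect. Qed.

HB.instance Definition _ := GRing.ComNzRing_hasMulInverse.Build Zpn
  Zpn_mulVx Zpn_unitPl Zpn_invr_out.

Definition Zpn_q : Zpn := Zpn_pi 'X.

Lemma qint_Zpn_nil : qint Zpn_q (val p) ^+ n.+1 = 0.
Proof.
rewrite -rmorph_qint -rmorphXn -[RHS](rmorph0 Zpn_pi).
apply/eqP; rewrite -Quotient.idealrBE subr0.
by apply/asboolP; exists 1; rewrite mul1r.
Qed.

Lemma qint_Zpn_unit m : (0 < m < val p)%N -> qint Zpn_q m \is a GRing.unit.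
Proof.
move=> mp; apply/asboolP.
exact: (qint_inv (primeNP p) mp qint_Zpn_nil).
Qed.

End Zpn.
Arguments Zpn_ideal : clear implicits.
Arguments Zpn_pi : clear implicits.

Section ZpnProj.
Variables (p : primeN) (n : nat).

Definition Zpn_proj : Zpn p n.+1 -> Zpn p n :=
  @quot_map _ _ (Zpn_idealr p n.+1) (Zpn_idealr p n) idfun.

Fact Zpn_ideal_sub f : f \in Zpn_ideal p n.+1 -> f \in Zpn_ideal p n.
Proof.
move=> /asboolP[g ->]; apply/asboolP; exists (g * qint 'X (val p)).
by rewrite exprS mulrA.
Qed.

HB.instance Definition _ := GRing.isZmodMorphism.Build (Zpn p n.+1) (Zpn p n)
  Zpn_proj (quot_map_zmod_morphism (f := idfun) Zpn_ideal_sub).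
HB.instance Definition _ := GRing.isMonoidMorphism.Build (Zpn p n.+1) (Zpn p n)
  Zpn_proj (quot_map_monoid_morphism (f := idfun) Zpn_ideal_sub).

Lemma Zpn_proj_pi f : Zpn_proj (Zpn_pi p n.+1 f) = Zpn_pi p n f.
Proof. exact: (quot_map_pi (f := idfun) Zpn_ideal_sub). Qed.

Lemma Zpn_proj_q : Zpn_proj (Zpn_q p n.+1) = Zpn_q p n.
Proof. exact: Zpn_proj_pi. Qed.

End ZpnProj.

(* Q_n = (prod_p Z_{p,n}) / (bigoplus_p Z_{p,n}). *)

Section Qn.
Variable n : nat.

Definition Zprod : comNzRingType := dprod (fun p : primeN => Zpn p n).

Definition Zsum : pred Zprod :=
  fun f => `[< finite_set [set p | f p != 0] >].

Lemma primeN_infinite : ~ finite_set [set: primeN].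
Proof.
move=> /(finite_image val) /finite_seqP[s sE].
have [p lt_p pr] := prime_above (\max_(i <- s) i).
have : p \in s.
  suff : [set` s] p by [].
  by rewrite -sE; exists (exist _ p pr).
by move=> ps; move: lt_p; rewrite ltnNge (@leq_bigmax_seq _ s xpredT id p).
Qed.

Fact Zsum_closed : idealr_closed Zsum.
Proof.
split.
- apply/asboolP; apply: (sub_finite_set (B := set0)) => // p /=.
  by rewrite eqxx.
- apply/asboolP => fin; apply: primeN_infinite.
  by apply: sub_finite_set fin => p _ /=; exact: oner_neq0.
- move=> a u v /asboolP fu /asboolP fv; apply/asboolP.
  apply: (sub_finite_set (B := [set p | u p != 0] `|` [set p | v p != 0])).
    move=> p /=; move=> h; case: (eqVneq (u p) 0) => [up0|]; last by left.
    right; apply: contra_neq h => vp0.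
    have -> : (a * u + v) p = a p * u p + v p by [].
    by rewrite up0 vp0 mulr0 addr0.
  by rewrite finite_setU.
Qed.

HB.instance Definition _ := isIdealr.Build Zprod Zsum Zsum_closed.
Definition Zsum_idealr : idealr Zprod := Zsum.

Definition Qn : comNzRingType := {ideal_quot Zsum_idealr}.

Definition Qn_pi : Zprod -> Qn := \pi_{ideal_quot Zsum_idealr}.
HB.instance Definition _ := GRing.RMorphism.on Qn_pi.

End Qn.
Arguments Zsum : clear implicits.
Arguments Qn_pi : clear implicits.

Section QnProj.
Variable n : nat.

Definition Zprod_proj (f : Zprod n.+1) : Zprod n := fun p => Zpn_proj (f p).

Fact Zprod_proj_zmod_morphism : zmod_morphism Zprod_proj.
Proof.
by move=> f g; apply/functional_extensionality_dep => p; exact: rmorphB.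
Qed.
Fact Zprod_proj_monoid_morphism : monoid_morphism Zprod_proj.
Proof.
split=> [|f g]; apply/functional_extensionality_dep => p.
  exact: rmorph1.
exact: rmorphM.
Qed.
HB.instance Definition _ := GRing.isZmodMorphism.Build _ _ Zprod_proj
  Zprod_proj_zmod_morphism.
HB.instance Definition _ := GRing.isMonoidMorphism.Build _ _ Zprod_proj
  Zprod_proj_monoid_morphism.

Definition Qn_proj : Qn n.+1 -> Qn n :=
  @quot_map _ _ (Zsum_idealr n.+1) (Zsum_idealr n) Zprod_proj.

Fact Zsum_sub f : f \in Zsum n.+1 -> Zprod_proj f \in Zsum n.
Proof.
move=> /asboolP ff; apply/asboolP; apply: sub_finite_set ff => p /=.
by apply: contra_neq => fp0; rewrite /Zprod_proj fp0 rmorph0.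
Qed.

HB.instance Definition _ := GRing.isZmodMorphism.Build (Qn n.+1) (Qn n)
  Qn_proj (quot_map_zmod_morphism (f := Zprod_proj) Zsum_sub).
HB.instance Definition _ := GRing.isMonoidMorphism.Build (Qn n.+1) (Qn n)
  Qn_proj (quot_map_monoid_morphism (f := Zprod_proj) Zsum_sub).

Lemma Qn_proj_pi f : Qn_proj (Qn_pi n.+1 f) = Qn_pi n (Zprod_proj f).
Proof. exact: (quot_map_pi (f := Zprod_proj) Zsum_sub). Qed.

End QnProj.

(* A family (x_n)_n in the product of the Q_n is in their inverse limit. *)
Definition Qcompatible : pred (dprod Qn) :=
  fun x => `[< forall n, Qn_proj (x n.+1) = x n >].

Fact Qcompatible_subring : subring_closed Qcompatible.
Proof.
split=> [|x y /asboolP cx /asboolP cy|x y /asboolP cx /asboolP cy];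
  apply/asboolP => n.
- exact: rmorph1.
- exact: etrans (rmorphB (@Qn_proj n) _ _) (congr2 (fun a b => a - b) (cx n) (cy n)).
- exact: etrans (rmorphM (@Qn_proj n) _ _) (congr2 *%R (cx n) (cy n)).
Qed.
HB.instance Definition _ :=
  GRing.isSubringClosed.Build (dprod Qn) Qcompatible Qcompatible_subring.

Record Qhat : Type := MkQhat { Qhat_val : dprod Qn; _ : Qcompatible Qhat_val }.

HB.instance Definition _ := [isSub for Qhat_val].
HB.instance Definition _ := [Choice of Qhat by <:].
HB.instance Definition _ := [SubChoice_isSubComNzRing of Qhat by <:].

Lemma QhatP (x : Qhat) n : Qn_proj (Qhat_val x n.+1) = Qhat_val x n.
Proof. by case: x => x c; move/asboolP: (c); exact. Qed.

Definition Qhat_comp n (x : Qhat) : Qn n := Qhat_val x n.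

HB.instance Definition _ n := GRing.isZmodMorphism.Build Qhat (Qn n)
  (Qhat_comp n) (fun _ _ => erefl).
HB.instance Definition _ n := GRing.isMonoidMorphism.Build Qhat (Qn n)
  (Qhat_comp n) (conj erefl (fun _ _ => erefl)).

Lemma Qhat_ext (x y : Qhat) : (forall n, Qhat_comp n x = Qhat_comp n y) -> x = y.
Proof.
by move=> xy; apply/val_inj/functional_extensionality_dep.
Qed.

(* The element ((f_{p,n})_p)_n of the limit. *)

Section OfFamily.
Variable f : forall n (p : primeN), Zpn p n.
Hypothesis fcompat : forall n p, Zpn_proj (f n.+1 p) = f n p.

Fact of_family_compat : Qcompatible (fun n => Qn_pi n (f n)).
Proof.
apply/asboolP => n; rewrite Qn_proj_pi; congr (Qn_pi n _).
by apply/functional_extensionality_dep => p; exact: fcompat.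
Qed.

Definition of_family : Qhat := MkQhat of_family_compat.

End OfFamily.

Definition Qhat_q : Qhat :=
  @of_family (fun n p => Zpn_q p n) (fun n p => Zpn_proj_q p n).

Fact qint_p_compat n (p : primeN) :
  Zpn_proj (qint (Zpn_q p n.+1) (val p)) = qint (Zpn_q p n) (val p).
Proof. by rewrite rmorph_qint [X in qint X]Zpn_proj_q. Qed.

(* The element [p] (bold p). *)
Definition Qhat_p : Qhat := of_family qint_p_compat.

(* The [p]-adic topology: the sets x + [p]^N Qhat form a neighbourhood basis
   of x. *)

Definition Qhat_nbhs (x : Qhat) : set_system Qhat :=
  [set A | exists N, forall y, A (x + Qhat_p ^+ N * y)].

HB.instance Definition _ := hasNbhs.Build Qhat Qhat_nbhs.
HB.instance Definition _ := isPointed.Build Qhat 0.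

Fact Qhat_nbhs_filter (x : Qhat) : ProperFilter (nbhs x).
Proof.
split; first by move=> [N /(_ 0)].
split; first by exists 0%N.
- move=> A B [N AN] [M BM]; exists (N + M)%N => y; split.
    by rewrite exprD -mulrA; exact: AN.
  by rewrite addnC exprD -mulrA; exact: BM.
- by move=> A B AB [N AN]; exists N => y; exact/AB/AN.
Qed.

Fact Qhat_nbhs_singleton (x : Qhat) (A : set Qhat) : nbhs x A -> A x.
Proof. by move=> [N /(_ 0)]; rewrite mulr0 addr0. Qed.

Fact Qhat_nbhs_nbhs (x : Qhat) (A : set Qhat) :
  nbhs x A -> nbhs x (nbhs^~ A).
Proof.
move=> [N AN]; exists N => y; exists N => z.
by rewrite -addrA -mulrDr; exact: AN.
Qed.

HB.instance Definition _ := Nbhs_isNbhsTopological.Build Qhat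
  Qhat_nbhs_filter Qhat_nbhs_singleton Qhat_nbhs_nbhs.

Lemma Qhat_p_nil n N : (n < N)%N -> Qhat_comp n (Qhat_p ^+ N) = 0.
Proof.
move=> nN; rewrite -(subnKC nN) exprD rmorphM rmorphXn.
suff -> : Qhat_comp n Qhat_p ^+ n.+1 = 0 by rewrite mul0r.
rewrite [Qhat_comp n _]/(Qn_pi n _) -rmorphXn -[RHS](rmorph0 (Qn_pi n)).
congr (Qn_pi n _); apply/functional_extensionality_dep => p.
rewrite -[LHS]/(dproj p _) rmorphXn; exact: qint_Zpn_nil.
Qed.

Lemma Qhat_hausdorff : hausdorff_space Qhat.
Proof.
move=> x y xy; apply: Qhat_ext => n.
have [||z [[u _ uz] [v _ vz]]] := xy
    [set x + Qhat_p ^+ n.+1 * u | u in setT]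
    [set y + Qhat_p ^+ n.+1 * v | v in setT].
- by exists n.+1 => u; exists u.
- by exists n.+1 => v; exists v.
have comp w t : Qhat_comp n (w + Qhat_p ^+ n.+1 * t) = Qhat_comp n w.
  by rewrite rmorphD [X in _ + X]rmorphM /= Qhat_p_nil // mul0r addr0.
by rewrite -(comp x u) uz -vz comp.
Qed.

(* Convergence of the series used below, whose terms have this shape by exprMn;
   with Qhat_hausdorff, limn is their sum. *)
Lemma Qhat_series_cvg (a : nat -> Qhat) :
  cvgn (fun N => \sum_(l < N) a l * Qhat_p ^+ l).
Proof.
pose S (a : nat -> Qhat) : dprod Qn :=
  fun n => Qhat_comp n (\sum_(l < n.+1) a l * Qhat_p ^+ l).
have compS b : Qcompatible (S b).
  apply/asboolP => n; rewrite /S [LHS]QhatP -[LHS]/(Qhat_comp n _) big_ord_recr.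
  by rewrite [LHS]rmorphD [X in _ + X]rmorphM /= Qhat_p_nil // mulr0 addr0.
have SE b n N : (n < N)%N ->
    S b n = Qhat_comp n (\sum_(l < N) b l * Qhat_p ^+ l).
  move=> nN; rewrite -(subnKC nN) big_split_ord [RHS]rmorphD.
  rewrite [X in _ + X]rmorph_sum [X in _ + X]big1 ?addr0 // => i _.
  by rewrite rmorphM /= Qhat_p_nil ?mulr0 // ltn_addr.
have tail M : MkQhat (compS a) = \sum_(l < M) a l * Qhat_p ^+ l
    + Qhat_p ^+ M * MkQhat (compS (fun l => a (M + l)%N)).
  apply: Qhat_ext => n; rewrite rmorphD [X in _ + X]rmorphM.
  rewrite [LHS](@SE a n (M + n.+1)%N) ?ltn_addl // big_split_ord [LHS]rmorphD.
  congr (_ + _).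
  rewrite -[X in _ * X]/(Qhat_comp n (\sum_(l < n.+1) a (M + l)%N * Qhat_p ^+ l)).
  rewrite -rmorphM mulr_sumr.
  by congr Qhat_comp; apply: eq_bigr => i _; rewrite exprD mulrCA.
apply/cvg_ex; exists (MkQhat (compS a)) => A [N AN].
exists N => // M /= NM.
have -> : \sum_(l < M) a l * Qhat_p ^+ l = MkQhat (compS a) +
    Qhat_p ^+ N * (- Qhat_p ^+ (M - N) * MkQhat (compS (fun l => a (M + l)%N))).
  by rewrite mulrA mulrN -exprD subnKC // (tail M) mulNr addrK.
exact: AN.
Qed.

(* q^{-p} (bold p). *)
Definition Qhat_qinvp : Qhat :=
  limn (fun N => \sum_(j < N) (Qhat_p * (1 - Qhat_q)) ^+ j).

(* Indices are finite sequences of positive integers; tuples of non-negative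
   integers are sequences of natural numbers as well. *)

Definition is_index : pred (seq nat) := all (ltn 0).
Notation dep := (@size nat) (only parsing).
Notation wt := sumn (only parsing).

(* All the results of replacing some of the commas of k by plus signs: the
   first comma is kept in the first half of the list and replaced in the
   second. *)
Fixpoint coarsenings (k : seq nat) : seq (seq nat) :=
  match k with
  | [::] => [:: [::]]
  | [:: a] => [:: [:: a]]
  | a :: k' => [seq a :: l | l <- coarsenings k'] ++
               [seq (a + head 0 l)%N :: behead l | l <- coarsenings k']
  end.

Definition preceq (l k : seq nat) : bool := l \in coarsenings k.

Definition oplus (l k : seq nat) : seq nat :=
  [seq (x.1 + x.2)%N | x <- zip l k].

(* (l_1 + 1, {1}^(k_1 - 1), ..., l_r + 1, {1}^(k_r - 1)) *)
Definition oslash (l k : seq nat) : seq nat :=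
  flatten [seq x.1.+1 :: nseq x.2.-1 1%N | x <- zip l k].

(* The sum over 0 < m_1 < ... < m_r <= N of the products of
   q^(e(k_j) m_j) / [m_j]^(k_j), with e(k) = k - 1 for BZ and e(k) = k for SZ.
   It is evaluated directly in the target ring (here Z_{p,n}, with N = p - 1),
   where the [m_j] are invertible, instead of in Q(q). *)
Definition zetaq (e : nat -> nat) (R : comUnitRingType) (q : R) (N : nat)
    (k : seq nat) : R :=
  \sum_(m : (dep k).-tuple 'I_N.+1 | path ltn 0%N [seq val i | i <- m])
    \prod_(j < dep k)
      (q ^+ (e (nth 0%N k j) * tnth m j) / qint q (tnth m j) ^+ nth 0%N k j).

Definition zetaBZ (R : comUnitRingType) (q : R) := zetaq predn q.
Definition zetaSZ (R : comUnitRingType) (q : R) := zetaq id q.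

Lemma rmorph_zetaq e (R S : comUnitRingType) (f : {rmorphism R -> S}) q N k :
  (forall m, (0 < m <= N)%N -> qint q m \is a GRing.unit) ->
  f (zetaq e q N k) = zetaq e (f q) N k.
Proof.
move=> qu; rewrite rmorph_sum; apply: eq_bigr => m lt_m.
rewrite rmorph_prod; apply: eq_bigr => j _.
have m_gt0 : (0 < tnth m j)%N.
  have /(order_path_min ltn_trans)/allP := lt_m; apply.
  by apply: map_f; exact: mem_tnth.
have m_le : (tnth m j <= N)%N by rewrite -ltnS.
by rewrite rmorphM rmorphV ?unitrX ?qu ?m_gt0 // !rmorphXn rmorph_qint.
Qed.

Fact zetaq_compat e k n (p : primeN) :
  Zpn_proj (zetaq e (Zpn_q p n.+1) (val p).-1 k) =
  zetaq e (Zpn_q p n) (val p).-1 k.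
Proof.
rewrite -[in RHS]Zpn_proj_q; apply: rmorph_zetaq => m m_lt.
by apply: qint_Zpn_unit; rewrite -(prednK (prime_gt0 (primeNP p))).
Qed.

Definition Qhat_zetaBZ (k : seq nat) : Qhat :=
  @of_family (fun n p => zetaBZ (Zpn_q p n) (val p).-1 k) (zetaq_compat predn k).

Definition Qhat_zetaSZ (k : seq nat) : Qhat :=
  @of_family (fun n p => zetaSZ (Zpn_q p n) (val p).-1 k) (zetaq_compat id k).

(* Main.v *)
(** Put f(m) = q^m / [m].  With N = p - 1, the BZ sum is first rewritten as a
    sum over blocks n_1 <= ... <= n_a of indices, consecutive blocks being
    separated by a strict inequality, where a block of length a contributes
    f(n_2) ... f(n_a) / [p - n_1].  This is a q-analogue of the
    Maesaka-Seki-Watanabe identity and follows from a connected sum with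
    connector binom(m, n)_q / binom(N, n)_q: its differences K(n, m) in m
    intertwine the summations building the BZ sum with those building the
    block sum, and K(0, m) is the Kronecker delta at m = 0.  Since
      [p - m] = - q^(p-m) [m] (1 - [p] q^(-p) f(m)),
    expanding 1 / [p - n_1] as a geometric series turns f(n_1) into
    f(n_1)^(l + 1) with the factor - q^(-p) ([p] q^(-p))^l, and splitting each
    weak inequality inside a block into < and = gives the SZ sums over m with
    l (+) k <= m <= l (/) k.  All this takes place in each Z_{p,n}, where [p]
    is nilpotent. *)
Require Import Defs.
From mathcomp Require Import all_boot all_order all_algebra.
From mathcomp Require Import boolp classical_sets topology.
From mathcomp Require Import ring zify.

Import GRing.Theory.
Local Open Scope ring_scope.
Local Open Scope classical_set_scope.

(** * Finite sums: the connected sum for the BZ values *)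

Lemma exchange_triangle {V : nmodType} (F : nat -> nat -> V) d N :
  \sum_(0 <= i < N) \sum_(d + i <= j < N) F i j =
  \sum_(d <= j < N) \sum_(0 <= i < (j - d).+1) F i j.
Proof.
under eq_bigr => i _ do rewrite (@big_nat_widenl _ _ _ _ d) ?leq_addr //.
rewrite (exchange_big_dep_nat (fun=> true)) //.
apply: eq_big_nat => j /andP[dj jN].
rewrite [RHS](@big_nat_widen _ _ _ _ _ N); last by lia.
by apply: eq_bigl => i; apply/idP/idP; lia.
Qed.

Section FiniteIdentity.
Variables (R : comUnitRingType) (q : R) (N : nat).
Hypothesis qu : forall m, (0 < m <= N)%N -> qint q m \is a GRing.unit.

Local Notation "[ m ]" := (qint q m).

Lemma qintD a b : [a + b] = [a] + q ^+ a * [b].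
Proof.
rewrite /qint big_split_ord /= mulr_sumr; congr (_ + _).
by apply: eq_bigr => i _; rewrite exprD.
Qed.

Lemma qint0 : [0] = 0. Proof. exact: big_ord0. Qed.

Lemma qintB a b : (b <= a)%N -> [a] - [b] = q ^+ b * [a - b].
Proof. by move=> ba; rewrite -{1}(subnKC ba) qintD addrAC subrr add0r. Qed.

Definition qterm m : R := q ^+ m / [m].

(* The quotient binom(m, n)_q / binom(N, n)_q; it vanishes for n > m because
   m - i is truncated and so takes the value 0. *)
Definition connector n m : R := \prod_(i < n) ([m - i] / [N - i]).

Definition kernel n m : R :=
  connector n m - (if m is m'.+1 then connector n m' else 0).

Definition kernel_sum n (g : nat -> R) : R :=
  \sum_(0 <= m < N.+1) kernel n m * g m.

Lemma connector0 m : connector 0 m = 1. Proof. exact: big_ord0. Qed.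

Lemma connectorSl n m : connector n.+1 m = connector n m * ([m - n] / [N - n]).
Proof. exact: big_ord_recr. Qed.

(** With the first numerator [[m.+1]] and the last denominator [[N - n]] set aside, the remaining
    factors pair up as [connector n m]. *)
Lemma connectorS n m : connector n.+1 m.+1 = [m.+1] / [N - n] * connector n m.
Proof.
elim: n => [|n IHn]; first by rewrite connectorSl !connector0 !subn0; ring.
by rewrite connectorSl IHn connectorSl subSS; ring.
Qed.

Lemma connector_small n m : (m < n)%N -> connector n m = 0.
Proof.
by move=> mn; rewrite /connector (bigD1 (Ordinal mn)) //= subnn qint0 !mul0r.
Qed.

Lemma connector_max n : (n <= N)%N -> connector n N = 1.
Proof.
move=> nN; apply: big1 => i _; apply: divrr; apply: qu.
by have := ltn_ord i; lia.
Qed.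

Lemma sum_kernel n m : \sum_(0 <= i < m.+1) kernel n i = connector n m.
Proof.
elim: m => [|m IHm]; first by rewrite big_nat1 /kernel subr0.
by rewrite big_nat_recr //= IHm addrC subrK.
Qed.

Lemma kernel0n m : kernel 0 m = (m == 0)%:R.
Proof. by case: m => [|m]; rewrite /kernel !connector0 ?subr0 ?subrr. Qed.

Lemma kernelS n m : (n < N)%N ->
  kernel n.+1 m.+1 = [n.+1] * (q ^+ (m - n) * connector n m / [N - n]).
Proof.
move=> nN; rewrite /kernel connectorS connectorSl.
have [mn|nm] := ltnP m n; first by rewrite connector_small //; ring.
have e : [m.+1] - [m - n] = q ^+ (m - n) * [n.+1].
  by rewrite qintB; [congr (_ * [_]); lia|lia].
transitivity (([m.+1] - [m - n]) * (connector n m / [N - n])); first by ring.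
by rewrite e; ring.
Qed.

(** Local form of the intertwining with [tail_sum]. At [m = 0] both sides vanish, since
    [connector n 0 = 0] for positive [n]. *)
Lemma qterm_kernel n m : (0 < n <= N)%N -> (m <= N)%N ->
  qterm n * kernel n m = connector n m * qterm m.
Proof.
case: n => // n /= nN; case: m => [|m] mN.
  by rewrite /kernel subr0 connector_small // mulr0 mul0r.
rewrite kernelS // connectorS /qterm.
have [mn|nm] := ltnP m n; first by rewrite connector_small //; ring.
rewrite mulrA divrK ?qu // ?mulrA -?exprD.
rewrite [_ * (q ^+ m.+1)]mulrC.
have -> : (n.+1 + (m - n) = m.+1)%N by lia.
rewrite -[q ^+ m.+1 in LHS](@divrK _ [m.+1]) ?qu //; ring.
Qed.

(** The right side is a difference in [n], prepared for telescoping. For [n <= m] it rests on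
    [[N - n] - [m - n] = q ^+ (m - n) * [N - m]]. *)
Lemma kernel_qint n m : (n < N)%N -> (m < N)%N ->
  [n.+1]^-1 * kernel n.+1 m.+1 = [N - m]^-1 * (connector n m - connector n.+1 m).
Proof.
move=> nN mN; rewrite kernelS // mulKr ?qu // connectorSl.
have [mn|nm] := ltnP m n; first by rewrite connector_small //; ring.
have e : [N - n] - [m - n] = q ^+ (m - n) * [N - m].
  by rewrite qintB; [congr (_ * [_]); lia|lia].
have un : [N - n] \is a GRing.unit by apply: qu; lia.
have um : [N - m] \is a GRing.unit by apply: qu; lia.
rewrite -[X in X - _](mulrK un) -mulrA -[X in X - _]mulrA -mulrBr mulrA -mulrBl e.
by rewrite -[LHS](mulKr um); ring.
Qed.

Lemma sum_kernel_qint n m : (n <= N)%N -> (m < N)%N ->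
  \sum_(n.+1 <= n' < N.+1) [n']^-1 * kernel n' m.+1 = connector n m / [N - m].
Proof.
move=> nN mN; rewrite big_add1 /= mulrC.
rewrite (telescope_sumr_eq (fun i => - ([N - m]^-1 * connector i m))) //.
  (* The upper boundary term [connector N m] vanishes because [m < N]. *)
  by rewrite (@connector_small N) //; ring.
by move=> i /andP[ni iN]; rewrite kernel_qint //; ring.
Qed.

Definition tail_sum (g : nat -> R) m : R := \sum_(m <= i < N.+1) qterm i * g i.

Definition reflected_sum (g : nat -> R) m : R :=
  \sum_(m.+1 <= i < N.+1) [N.+1 - i]^-1 * g i.

Lemma kernel_sum_tail n g : (0 < n <= N)%N ->
  qterm n * kernel_sum n g = kernel_sum n (tail_sum g).
Proof.
move=> nN; rewrite /kernel_sum /tail_sum mulr_sumr.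
under [RHS]eq_bigr => m _ do rewrite mulr_sumr.
rewrite (exchange_triangle _ 0) /=; apply: eq_big_nat => m /andP[_ mN].
by rewrite subn0 -mulr_suml sum_kernel mulrA qterm_kernel ?mulrA.
Qed.

Lemma kernel_sum_iter n g a : (0 < n <= N)%N ->
  qterm n ^+ a * kernel_sum n g = kernel_sum n (iter a tail_sum g).
Proof.
move=> nN; elim: a => [|a IHa]; first by rewrite mul1r.
by rewrite exprS -mulrA IHa kernel_sum_tail.
Qed.

(** Both sides reduce to the sum of [connector n m / [N - m] * g m.+1] over [m < N]: the left by
    telescoping in [n'], the right by telescoping in the second argument of the kernel. *)
Lemma kernel_sum_reflected n g : (n <= N)%N ->
  \sum_(n.+1 <= n' < N.+1) [n']^-1 * kernel_sum n' g = kernel_sum n (reflected_sum g).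
Proof.
move=> nN; rewrite /kernel_sum /reflected_sum.
under [LHS]eq_bigr => n' _ do rewrite mulr_sumr.
under [RHS]eq_bigr => m _ do rewrite mulr_sumr.
rewrite (exchange_triangle _ 1) /= exchange_big_nat /=.
(* The term with second argument 0 drops out: [n'] is positive, so [kernel n' 0 = 0]. *)
rewrite big_ltn // big_nat big1 ?add0r => [|n' /andP[nn' _]]; last first.
  by rewrite /kernel subr0 connector_small ?mul0r ?mulr0 //; lia.
rewrite !big_add1 /=; apply: eq_big_nat => m /andP[_ mN].
under eq_bigr => n' _ do rewrite mulrA.
by rewrite -!mulr_suml sum_kernel_qint // subn1 sum_kernel subSS mulrA.
Qed.

Fixpoint nested (h : nat -> nat -> R) (k : seq nat) (x : nat) : R :=
  if k is a :: k' then \sum_(x.+1 <= m < N.+1) h a m * nested h k' m else 1.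

(** The block sum: an entry [a] is a block of [a] indices, the first strictly above the previous
    block, the other [a.-1] weakly increasing. *)
Fixpoint reflected_nested (k : seq nat) : nat -> R :=
  if k is a :: k' then reflected_sum (iter a.-1 tail_sum (reflected_nested k'))
  else fun=> 1.

(** The lower bound [n] of the nested sum becomes the first argument of the kernel, so the induction
    must cover all [n]; only [n = 0] is wanted in the end. *)
Lemma nested_kernel k n : (n <= N)%N ->
  nested (fun a m => qterm m ^+ a.-1 / [m]) k n = kernel_sum n (reflected_nested k).
Proof.
elim: k n => [|a k IHk] n nN /=.
  rewrite /kernel_sum; under eq_bigr do rewrite mulr1.
  by rewrite sum_kernel connector_max.
rewrite -kernel_sum_reflected //; apply: eq_big_nat => m /andP[nm mN].
by rewrite IHk // [_ / _]mulrC -mulrA kernel_sum_iter //; lia.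
Qed.

Lemma nested_reflected k :
  nested (fun a m => qterm m ^+ a.-1 / [m]) k 0 = reflected_nested k 0.
Proof.
rewrite nested_kernel // /kernel_sum big_nat_recl // kernel0n mul1r.
by rewrite big1 ?addr0 // => i _; rewrite kernel0n mul0r.
Qed.

End FiniteIdentity.

(** * Coarsenings of indices *)

Lemma is_index_cons a s : is_index (a :: s) = (0 < a)%N && is_index s.
Proof. by []. Qed.

Definition merge_head (a : nat) (l : seq nat) : seq nat :=
  (a + head 0 l)%N :: behead l.

Lemma coarsenings_cons a b s :
  coarsenings (a :: b :: s) = [seq a :: l | l <- coarsenings (b :: s)] ++
                              [seq merge_head a l | l <- coarsenings (b :: s)].
Proof. by []. Qed.

Lemma coarsenings_merge a b s :
  coarsenings ((a + b)%N :: s) = [seq merge_head a l | l <- coarsenings (b :: s)].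
Proof.
case: s => [|c s] //; rewrite !coarsenings_cons map_cat -!map_comp.
by congr (_ ++ _); apply: eq_map => l; rewrite /merge_head /= addnA.
Qed.

Lemma coarsenings_head a s l : l \in coarsenings (a :: s) ->
  exists b l', l = (a + b)%N :: l'.
Proof.
case: s => [|b s]; first by rewrite inE => /eqP->; exists 0%N, [::]; rewrite addn0.
rewrite coarsenings_cons mem_cat => /orP[] /mapP[l' _ ->].
  by exists 0%N, l'; rewrite addn0.
by exists (head 0 l')%N, (behead l').
Qed.

Lemma coarsenings_index s l : is_index s -> l \in coarsenings s -> is_index l.
Proof.
elim: s l => [|a [|b s] IHs] l.
- by rewrite inE => _ /eqP->.
- by rewrite inE => ? /eqP->.
rewrite coarsenings_cons mem_cat /= => /andP[a0 s0] /orP[] /mapP[l' l's ->] /=.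
  by rewrite a0 IHs.
have := IHs _ s0 l's; case: l' {l's} => [|c l'] /=; first by rewrite addn_gt0 a0.
by rewrite addn_gt0 a0 => /andP[_].
Qed.

(** Nonemptiness matters: the default head 0 gives [[::]] and [[:: 0]] the same image. *)
Lemma merge_head_inj a : {in [pred l | l != [::]] &, injective (merge_head a)}.
Proof.
by move=> [|b l] [|c l'] //= _ _ [/addnI -> ->].
Qed.

(** With positive entries the head decides the fate of the first comma: head [a] means it is kept, a
    larger head means it is replaced. *)
Lemma mem_cons_coarsenings a u l : is_index l ->
  (a :: u \in coarsenings (a :: l)) = (u \in coarsenings l).
Proof.
case: l => [|b l]; first by rewrite !inE eqseq_cons eqxx.
rewrite is_index_cons => /andP[b0 _].
rewrite coarsenings_cons mem_cat mem_map; last by move=> ? ? [].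
rewrite orbC; case: mapP => // -[l' /coarsenings_head[c [l'' ->]]].
by case=> /=; lia.
Qed.

Lemma mem_merge_coarsenings a b u l : l != [::] ->
  ((a + b)%N :: u \in coarsenings (merge_head a l)) = (b :: u \in coarsenings l).
Proof.
case: l => [|c l] // _; rewrite -[merge_head _ _]/((a + c)%N :: l) coarsenings_merge.
apply/mapP/idP => [[l' l'l]|bu]; last by exists (b :: u).
have [d [l'' l'E]] := coarsenings_head _ _ _ l'l; subst l'.
by case=> /addnI -> ->.
Qed.

Lemma mem_cons_merge_coarsenings a b u l : (0 < b)%N -> l != [::] ->
  ((a + b)%N :: u \in coarsenings (a :: l)) = (b :: u \in coarsenings l).
Proof.
case: l => [|c l] // b0 _; rewrite coarsenings_cons mem_cat.
rewrite -coarsenings_merge.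
rewrite -[(a + c)%N :: l]/(merge_head a (c :: l)) mem_merge_coarsenings //.
by case: mapP => // -[? _ []]; lia.
Qed.

(** The two halves of the list are disjoint: the head is [a] in the first and larger than [a] in the
    second. *)
Lemma uniq_coarsenings s : is_index s -> uniq (coarsenings s).
Proof.
elim: s => [|a [|b s] IHs] // /andP[_ s0]; rewrite coarsenings_cons cat_uniq.
have b0 : (0 < b)%N by case/andP: s0.
have nz l : l \in coarsenings (b :: s) -> l \in [pred l | l != [::]].
  by move=> /coarsenings_head[c [l' ->]].
rewrite map_inj_uniq ?IHs //=; last by move=> ? ? [].
rewrite map_inj_in_uniq ?IHs //; last first.
  by move=> l l' /nz l0 /nz l'0; exact: merge_head_inj.
rewrite andbT; apply/hasPn => _ /mapP[l /coarsenings_head[c [l' ->]] ->].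
by apply/mapP => -[? _ []]; lia.
Qed.

(* The constraint on m forces the comma between s and r to survive in m. *)
Lemma coarsenings_cat s r u : s != [::] -> is_index s -> is_index r ->
  [seq m <- coarsenings (s ++ r) | sumn s :: u \in coarsenings m] =
  [seq c ++ m | c <- coarsenings s,
                m <- [seq m <- coarsenings r | u \in coarsenings m]].
Proof.
elim: s => [|a s IHs] // _; rewrite is_index_cons => /andP[a0 s0] r0.
case: s IHs s0 => [_ _|b s /(_ isT) IHs s0].
  rewrite -[sumn _]/(a + 0)%N addn0 -[_ ++ r]/(a :: r) -[coarsenings [:: a]]/[:: [:: a]].
  rewrite allpairs1l.
  transitivity (map (cons a) [seq m <- coarsenings r | u \in coarsenings m]).
    case: r r0 => [|b r] r0.
      by rewrite /= !inE eqseq_cons eqxx /=; case: (u == [::]).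
    (* Merging across the boundary with [r] makes the head exceed [a], so the second half
       contributes nothing. *)
    rewrite coarsenings_cons filter_cat [X in _ ++ X](_ : _ = [::]) ?cats0.
      rewrite filter_map; congr map; apply: eq_in_filter => m /= mr.
      exact/mem_cons_coarsenings/(coarsenings_index _ _ r0).
    apply/eqP; rewrite -[_ == _]negbK -has_filter -all_predC.
    apply/allP => _ /mapP[l lr ->] /=; apply/negP.
    move=> /coarsenings_head[d [l']] [].
    have [e [l'' lE]] := coarsenings_head _ _ _ lr.
    by move: r0; rewrite lE is_index_cons /= => /andP[]; lia.
  by apply: eq_map.
have b0 : (0 < sumn (b :: s))%N by move: s0; rewrite is_index_cons /= => /andP[]; lia.
rewrite !cat_cons !coarsenings_cons allpairs_cat filter_cat !filter_map.
rewrite -[sumn (a :: _)]/(a + sumn (b :: s))%N.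
have nz l : l \in coarsenings (b :: s ++ r) -> l != [::].
  by move=> /coarsenings_head[c [l' ->]].
rewrite allpairs_mapl allpairs_mapl.
(* Whether the first comma is kept or replaced, removing [a] from the prescribed head leads back to
   the induction hypothesis. *)
congr (_ ++ _).
  under eq_in_filter => m /nz m0 do rewrite /= mem_cons_merge_coarsenings //.
  by rewrite IHs // map_allpairs.
under eq_in_filter => m /nz m0 do rewrite /= mem_merge_coarsenings //.
rewrite IHs // map_allpairs; apply/eq_in_allpairs => c m /coarsenings_head[d [c' ->]] _.
by [].
Qed.

Lemma oslash_index l k : is_index (oslash l k).
Proof.
rewrite /oslash; elim: (zip l k) => // x s IHs.
by rewrite /is_index /= all_cat all_nseq orbT.
Qed.

(** * SZ sums over intervals of indices *)

Section NestedSums.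
Variables (R : comUnitRingType) (q : R) (N : nat).

Local Notation f := (qterm R q).
Local Notation T := (tail_sum R q N).
Local Notation sz := (nested R N (fun a m => f m ^+ a)).

Lemma tail_sumE g m : T g m = \sum_(m <= i < N.+1) f i * g i.
Proof. by []. Qed.

Lemma nested_pred a k x : (0 < x <= N)%N ->
  sz (a :: k) x.-1 = f x ^+ a * sz k x + sz (a :: k) x.
Proof. by case: x => // x xN; rewrite /= big_ltn. Qed.

(** A replaced comma identifies two consecutive summation variables and a kept one orders them
    strictly; together they give the weak inequalities of [T]. The step from the block to [m] stays
    strict. *)
Lemma sum_coarsenings_block l j m x :
  \sum_(c <- coarsenings (l :: nseq j 1%N)) sz (c ++ m) x =
  \sum_(x.+1 <= n < N.+1) f n ^+ l * iter j T (sz m) n.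
Proof.
elim: j l x => [|j IHj] l x; first by rewrite big_seq1.
rewrite -[nseq _ _]/(1%N :: nseq j 1%N) coarsenings_cons big_cat !big_map /=.
rewrite exchange_big [X in _ + X]exchange_big /= -big_split /=.
apply: eq_big_nat => n /andP[xn nN].
(* The bound [n.-1] lets the next variable start at [n] itself, which accounts for both halves at
   once. *)
transitivity (f n ^+ l * \sum_(c <- coarsenings (1%N :: nseq j 1%N)) sz (c ++ m) n.-1).
  rewrite mulr_sumr -big_split /= big_seq [RHS]big_seq.
  apply: eq_bigr => c /coarsenings_head[d [c' ->]].
  rewrite cat_cons nested_pred; last by lia.
  by rewrite /= exprD; ring.
rewrite IHj tail_sumE prednK; last by lia.
by congr (_ * _); apply: eq_bigr => i _; rewrite expr1.
Qed.

Definition interval_sum (t k : seq nat) x : R :=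
  \sum_(m <- undup (coarsenings (oslash t k)) | preceq (oplus t k) m) sz m x.

Lemma eq_iter_tail_sum j g g' : g =1 g' -> iter j T g =1 iter j T g'.
Proof. by move=> /funext->. Qed.

Lemma iter_tail_sum_lin (I : Type) (r : seq I) (c : I -> R) (g : I -> nat -> R) j x :
  iter j T (fun n => \sum_(i <- r) c i * g i n) x =
  \sum_(i <- r) c i * iter j T (g i) x.
Proof.
elim: j x => [|j IHj] x //; rewrite iterS tail_sumE.
under eq_bigr => n _ do rewrite IHj mulr_sumr.
under [RHS]eq_bigr do rewrite iterS tail_sumE.
rewrite exchange_big /=; apply: eq_bigr => i _; rewrite mulr_sumr.
by apply: eq_bigr => n _; rewrite mulrCA.
Qed.

Lemma interval_sum_nil x : interval_sum [::] [::] x = 1.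
Proof. by rewrite /interval_sum /= big_cons big_nil addr0. Qed.

(** The first entry [l + a] of [oplus] is the weight of the first block of [oslash], so
    [coarsenings_cat] splits each [m] at the end of that block. *)
Lemma interval_sum_cons l t a k x : (0 < a)%N ->
  interval_sum (l :: t) (a :: k) x =
  \sum_(x.+1 <= n < N.+1) f n ^+ l.+1 * iter a.-1 T (interval_sum t k) n.
Proof.
move=> a0; rewrite /interval_sum undup_id ?uniq_coarsenings ?oslash_index //.
rewrite -big_filter.
have -> : oslash (l :: t) (a :: k) = (l.+1 :: nseq a.-1 1%N) ++ oslash t k by [].
have -> : oplus (l :: t) (a :: k) = sumn (l.+1 :: nseq a.-1 1%N) :: oplus t k.
  rewrite [sumn _]/= sumn_nseq; congr (_ :: _).
  by rewrite -[LHS]/(l + a)%N; lia.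
rewrite /preceq coarsenings_cat ?oslash_index //=; last first.
  by rewrite /is_index all_nseq orbT.
rewrite big_allpairs_dep exchange_big /=.
under eq_bigr => m _ do rewrite sum_coarsenings_block.
rewrite exchange_big; apply: eq_bigr => n _.
rewrite -mulr_sumr; congr (_ * _).
transitivity (iter a.-1 T (fun n => \sum_(m <- [seq m <- coarsenings (oslash t k) |
                                         oplus t k \in coarsenings m]) 1 * sz m n) n).
  by rewrite iter_tail_sum_lin; under [RHS]eq_bigr do rewrite mul1r.
apply: eq_iter_tail_sum => {}n; rewrite big_filter.
rewrite /interval_sum undup_id ?uniq_coarsenings ?oslash_index //.
by apply: eq_bigr => m _; rewrite mul1r.
Qed.
End NestedSums.

(** * Sums over tuples and the geometric expansion *)

Lemma big_tuple_cons {V : nmodType} {I : finType} n (F : n.+1.-tuple I -> V) :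
  \sum_t F t = \sum_i \sum_(t : n.-tuple I) F [tuple of i :: t].
Proof.
rewrite pair_big /= (reindex (fun p : I * n.-tuple I => [tuple of p.1 :: p.2])) //.
exists (fun t : n.+1.-tuple I => (thead t, [tuple of behead t])) => [[i t]|t] _ /=.
  by rewrite theadE; congr (_, _); exact: val_inj.
by case/tupleP: t => i t; rewrite theadE; exact: val_inj.
Qed.

Lemma leq_sumn s x : x \in s -> (x <= sumn s)%N.
Proof.
elim: s => // a s IHs; rewrite inE => /predU1P[->|/IHs] /=; first exact: leq_addr.
by move=> xs; rewrite (leq_trans xs) ?leq_addl.
Qed.

(** No entry exceeds the weight. This reconciles the uniform bound [B] of the truncated geometric
    series with the bound [l.+1] of the theorem. *)
Lemma big_tuple_wt {V : nmodType} r l B (F : seq nat -> V) : (l < B)%N ->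
  \sum_(t : r.-tuple 'I_B | sumn [seq val i | i <- t] == l) F [seq val i | i <- t] =
  \sum_(t : r.-tuple 'I_l.+1 | sumn [seq val i | i <- t] == l)
    F [seq val i | i <- t].
Proof.
move=> lB; pose w := widen_ord lB.
pose back (i : 'I_B) : 'I_l.+1 := inord i.
have wE (t : r.-tuple 'I_l.+1) :
    [seq val i | i <- [tuple of map w t]] = [seq val i | i <- t].
  by rewrite -map_comp; apply: eq_map.
rewrite (reindex_onto (fun t : r.-tuple 'I_l.+1 => [tuple of map w t])
                      (fun t => [tuple of map back t])) => [|t /eqP tl].
  apply: eq_big => [t|t _]; rewrite wE //.
  suff -> : [tuple of map back [tuple of map w t]] = t by rewrite eqxx andbT.
  apply: val_inj; rewrite /= -map_comp -[RHS]map_id; apply: eq_map => i.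
  by apply: val_inj; rewrite /= inordK /= ?ltn_ord.
apply: val_inj; rewrite /= -map_comp -[RHS]map_id; apply/eq_in_map => i it.
apply: val_inj; rewrite /= inordK // ltnS -tl.
exact/leq_sumn/map_f.
Qed.

Section Expansion.
Variables (R : comUnitRingType) (q : R) (N : nat).

Local Notation f := (qterm R q).
Local Notation T := (tail_sum R q N).

Lemma nested_tuple (h : nat -> nat -> R) k x :
  \sum_(m : (size k).-tuple 'I_N.+1 | path ltn x [seq val i | i <- m])
    \prod_(j < size k) h (nth 0%N k j) (tnth m j) = nested R N h k x.
Proof.
elim: k x => [|a k IHk] x.
  rewrite (big_pred1 [tuple]) => [|t]; first by rewrite big_ord0.
  by rewrite tuple0; apply/esym/eqP.
rewrite big_mkcond big_tuple_cons /=.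
rewrite (@big_nat_widenl _ _ _ x.+1 0) // big_mkord [RHS]big_mkcond /=.
apply: eq_bigr => i _; case: ltnP => xi /=; last by apply: big1.
rewrite -IHk mulr_sumr big_mkcond [RHS]big_mkcond /=; apply: eq_bigr => t _.
case: ifP => // _; rewrite big_ord_recl tnth0 /=; congr (_ * _).
by apply: eq_bigr => j _; rewrite tnthS.
Qed.

Lemma eq_nested (h h' : nat -> nat -> R) k x : is_index k ->
  (forall a m, (0 < a)%N -> h a m = h' a m) -> nested R N h k x = nested R N h' k x.
Proof.
move=> + hh'; elim: k x => // a k IHk x; rewrite is_index_cons => /andP[a0 k0] /=.
by apply: eq_bigr => m _; rewrite hh' // IHk.
Qed.

Lemma zetaSZ_nested k : zetaSZ q N k = nested R N (fun a m => f m ^+ a) k 0.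
Proof.
rewrite /zetaSZ /zetaq -nested_tuple; apply: eq_bigr => m _; apply: eq_bigr => j _.
by rewrite /qterm expr_div_n mulnC exprM.
Qed.

Lemma zetaBZ_nested k : is_index k ->
  zetaBZ q N k = nested R N (fun a m => f m ^+ a.-1 / qint q m) k 0.
Proof.
move=> k0; rewrite /zetaBZ /zetaq (nested_tuple (fun a m => q ^+ (a.-1 * m) / qint q m ^+ a)).
apply: eq_nested => // -[|a] m // _ /=.
by rewrite /qterm expr_div_n mulnC exprM -[in LHS]exprVn exprSr exprVn mulrA.
Qed.

(** Each block contributes one factor [- u] and one exponent [i], which becomes its entry of [t]. In
    the application [u] is [q^{-p}] and [X] is [[p] q^{-p}]. *)
Lemma reflected_nested_expand (u X : R) B k x :
  (forall m, (0 < m <= N)%N ->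
    (qint q (N.+1 - m))^-1 = - u * \sum_(i < B) X ^+ i * f m ^+ i.+1) ->
  is_index k ->
  reflected_nested R q N k x = (- u) ^+ size k *
    \sum_(t : (size k).-tuple 'I_B)
      X ^+ sumn [seq val i | i <- t] * interval_sum R q N [seq val i | i <- t] k x.
Proof.
move=> qinv; elim: k x => [|a k IHk] x.
  move=> _; rewrite (big_pred1 [tuple]) => [|t]; last exact/esym/eqP/tuple0.
  by rewrite interval_sum_nil !mulr1.
rewrite is_index_cons => /andP[a0 k0] /=.
transitivity (\sum_(x.+1 <= m < N.+1) \sum_(i < B)
    \sum_(t : (size k).-tuple 'I_B)
     (- u) ^+ (size k).+1 * X ^+ (i + sumn [seq val i | i <- t]) * (f m ^+ i.+1 *
      iter a.-1 T (interval_sum R q N [seq val i | i <- t] k) m)).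
  apply: eq_big_nat => m /andP[xm mN]; rewrite qinv; last by lia.
  transitivity ((- u * \sum_(i < B) X ^+ i * f m ^+ i.+1) * iter a.-1 T (fun n =>
     \sum_(t : (size k).-tuple 'I_B) ((- u) ^+ size k * X ^+ sumn [seq val i | i <- t])
        * interval_sum R q N [seq val i | i <- t] k n) m).
    congr (_ * _); apply: eq_iter_tail_sum => n; rewrite IHk // mulr_sumr.
    by apply: eq_bigr => t _; rewrite mulrA.
  rewrite iter_tail_sum_lin -mulrA mulr_suml mulr_sumr; apply: eq_bigr => i _.
  rewrite mulrA mulr_sumr; apply: eq_bigr => t _.
  rewrite -[iter _ _ [eta _] _]/(iter a.-1 T (interval_sum R q N (map val t) k) m).
  by rewrite !exprS exprD; ring.
rewrite big_tuple_cons mulr_sumr exchange_big; apply: eq_bigr => i _.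
rewrite mulr_sumr exchange_big; apply: eq_bigr => t _ /=.
by rewrite interval_sum_cons // -mulr_sumr mulrA.
Qed.

Lemma big_wt_nilp (X : R) B r (F : seq nat -> R) : X ^+ B = 0 ->
  \sum_(t : r.-tuple 'I_B) X ^+ sumn [seq val i | i <- t] * F [seq val i | i <- t] =
  \sum_(l < B) (\sum_(t : r.-tuple 'I_l.+1 | sumn [seq val i | i <- t] == l)
                  F [seq val i | i <- t]) * X ^+ l.
Proof.
move=> XB.
under [RHS]eq_bigr => l _ do rewrite -(@big_tuple_wt _ _ _ B) // mulr_suml.
under [RHS]eq_bigr => l _ do rewrite big_mkcond.
rewrite [RHS]exchange_big; apply: eq_bigr => t _; rewrite -big_mkcond /=.
set s := map _ _; have [sB|Bs] := ltnP (sumn s) B.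
  by rewrite (big_pred1 (Ordinal sB)) /= 1?mulrC // => l; rewrite eq_sym.
(* A tuple of weight at least [B] is killed by [X ^+ B = 0] on the left and matches no [l] on the
   right. *)
rewrite -(subnKC Bs) exprD XB !mul0r big1 // => l /eqP lE.
by have := ltn_ord l; lia.
Qed.

End Expansion.

(** The right side of the theorem with both series cut at [B]. Being polynomial in its data, it can
    be carried along ring morphisms. *)
Definition zeta_expansion {R : comNzRingType} (z : seq nat -> R) (q P : R) B k : R :=
  let u := \sum_(j < B) (P * (1 - q)) ^+ j in
  (- u) ^+ size k *
  \sum_(l < B)
     (\sum_(t : (size k).-tuple 'I_l.+1 | sumn [seq val i | i <- t] == l)
        \sum_(m <- undup (coarsenings (oslash [seq val i | i <- t] k))
                | preceq (oplus [seq val i | i <- t] k) m) z m) * (P * u) ^+ l.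

Lemma rmorph_zeta_expansion (R S : comNzRingType) (g : {rmorphism R -> S}) z q P B k :
  g (zeta_expansion z q P B k) = zeta_expansion (g \o z) (g q) (g P) B k.
Proof.
have gu : g (\sum_(j < B) (P * (1 - q)) ^+ j) = \sum_(j < B) (g P * (1 - g q)) ^+ j.
  by rewrite rmorph_sum; apply: eq_bigr => j _; rewrite rmorphXn rmorphM rmorphB rmorph1.
rewrite /zeta_expansion /= rmorphM rmorphXn rmorphN gu; congr (_ * _).
rewrite rmorph_sum; apply: eq_bigr => l _; rewrite rmorphM rmorphXn rmorphM gu.
congr (_ * _); rewrite rmorph_sum; apply: eq_bigr => t _.
exact: rmorph_sum.
Qed.

Lemma sum_nilp (R : comNzRingType) (y : R) B : y ^+ B = 0 ->
  (1 - y) * \sum_(i < B) y ^+ i = 1.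
Proof. by move=> yB; rewrite -opprB mulNr -subrX1 yB sub0r opprK. Qed.

Lemma zetaBZ_expand (R : comUnitRingType) (q : R) N B k :
  (forall m, (0 < m <= N)%N -> qint q m \is a GRing.unit) ->
  qint q N.+1 ^+ B = 0 -> is_index k ->
  zetaBZ q N k = zeta_expansion (zetaSZ q N) q (qint q N.+1) B k.
Proof.
move=> qu PB k0; rewrite /zeta_expansion; set P := qint q N.+1 in PB *.
set u := \sum_(j < B) _.
(* Hence the truncated series [u] is the inverse of [q ^+ N.+1]. *)
have qN : q ^+ N.+1 = 1 - P * (1 - q).
  by rewrite /P -[q ^+ _](addrNK 1) subrX1 /qint; ring.
have uq : q ^+ N.+1 * u = 1 by rewrite qN sum_nilp // exprMn PB mul0r.
rewrite zetaBZ_nested // nested_reflected //.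
rewrite (@reflected_nested_expand _ _ _ u (P * u) B) //.
  rewrite (big_wt_nilp _ _ _ _ (fun t => interval_sum R q N t k 0%N)) ?exprMn ?PB ?mul0r //; congr (_ * _).
  apply: eq_bigr => l _; congr (_ * _); apply: eq_bigr => t _.
  by rewrite /interval_sum; apply: eq_bigr => m _; rewrite zetaSZ_nested.
move=> m mN.
have um : qint q (N.+1 - m) \is a GRing.unit by apply: qu; lia.
set y := P * u * qterm R q m.
have fE : q ^+ m = qterm R q m * qint q m by rewrite /qterm divrK ?qu.
have yB : y ^+ B = 0 by rewrite /y !exprMn PB !mul0r.
(* Reflection formula: multiply [P = [N.+1 - m] + q ^+ (N.+1 - m) * [m]] by [u * qterm R q m]; the
   last term becomes [q ^+ N.+1 * u = 1]. *)
have key : qint q (N.+1 - m) * (- u * qterm R q m) = 1 - y.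
  have PE : P = qint q (N.+1 - m) + q ^+ (N.+1 - m) * qint q m.
    by rewrite /P -qintD; congr qint; lia.
  have qE : q ^+ N.+1 = q ^+ (N.+1 - m) * (qterm R q m * qint q m).
    by rewrite -fE -exprD subnK //; lia.
  by rewrite -[in RHS]uq qE /y [in RHS]PE; ring.
apply: (mulrI um); rewrite mulrV // -(@sum_nilp _ y B) // -key -!mulrA.
congr (_ * (_ * _)); rewrite mulrA mulr_sumr; apply: eq_bigr => i _.
by rewrite -[_ / _]/(qterm R q m) exprMn exprS mulrCA.
Qed.

(** * Passage to the inverse limit *)

Lemma Qhat_lim_series_comp (a : nat -> Qhat) n :
  Qhat_comp n (limn (fun L => \sum_(l < L) a l * Qhat_p ^+ l)) =
  Qhat_comp n (\sum_(l < n.+1) a l * Qhat_p ^+ l).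
Proof.
set S := fun L => _; set s := limn S.
have Ss : S @ \oo --> s by exact: Qhat_series_cvg.
(* All points of this neighbourhood share the component [n] of [s], so a late partial sum computes
   it. *)
have [|M _ SM] := Ss [set s + Qhat_p ^+ n.+1 * y | y in setT].
  by exists n.+1 => y; exists y.
have [y _ yE] := SM (M + n.+1)%N (leq_addr _ _).
transitivity (Qhat_comp n (S (M + n.+1)%N)).
  by rewrite -yE rmorphD [X in _ + X]rmorphM /= Qhat_p_nil // mul0r addr0.
rewrite /S addnC big_split_ord [LHS]rmorphD [X in _ + X]rmorph_sum.
rewrite [X in _ + X]big1 ?addr0 // => i _.
by rewrite rmorphM /= Qhat_p_nil ?mulr0 // ltn_addr.
Qed.

Lemma Qhat_qinvp_comp n :
  Qhat_comp n Qhat_qinvp = Qhat_comp n (\sum_(j < n.+1) (Qhat_p * (1 - Qhat_q)) ^+ j).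
Proof.
rewrite /Qhat_qinvp; under eq_fun do under eq_bigr do rewrite exprMn mulrC.
rewrite (Qhat_lim_series_comp (fun j => (1 - Qhat_q) ^+ j)).
by congr Qhat_comp; apply: eq_bigr => j _; rewrite exprMn mulrC.
Qed.

Theorem theorem2 (k : seq nat) (hk : is_index k) :
  Qhat_zetaBZ k =
    (- Qhat_qinvp) ^+ dep k *
    limn (fun L => \sum_(l < L)
      (\sum_(t : (dep k).-tuple 'I_l.+1 | wt [seq val i | i <- t] == l)
         \sum_(m <- undup (coarsenings (oslash [seq val i | i <- t] k))
                 | preceq (oplus [seq val i | i <- t] k) m)
           Qhat_zetaSZ m)
      * (Qhat_p * Qhat_qinvp) ^+ l).
Proof.
apply: Qhat_ext => n.
(* Cutting at [n.+1] is exact here: component [n] lives modulo [[p] ^+ n.+1]. *)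
transitivity (Qhat_comp n (zeta_expansion Qhat_zetaSZ Qhat_q Qhat_p n.+1 k)).
  rewrite rmorph_zeta_expansion.
  (* The expansion is lifted to the product over all primes, where it can be checked one prime at a
     time. *)
  transitivity (Qn_pi n (zeta_expansion
      (fun m => (fun p => zetaSZ (Zpn_q p n) (val p).-1 m) : Zprod n)
      (fun p => Zpn_q p n) (fun p => qint (Zpn_q p n) (val p)) n.+1 k)).
    rewrite [LHS]/(Qn_pi n _); congr (Qn_pi n _).
    apply/functional_extensionality_dep => p.
    rewrite -[RHS]/(dproj p _) rmorph_zeta_expansion.
    have p1 : (val p).-1.+1 = val p by rewrite prednK ?prime_gt0 ?primeNP.
    have := @zetaBZ_expand _ (Zpn_q p n) (val p).-1 n.+1 k; rewrite p1; apply=> //.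
      by move=> m mp; apply: qint_Zpn_unit; rewrite -p1.
    exact: qint_Zpn_nil.
  exact: rmorph_zeta_expansion.
rewrite /zeta_expansion [LHS]rmorphM [RHS]rmorphM !rmorphXn !rmorphN /=.
rewrite Qhat_qinvp_comp; congr (_ * _).
(* Each term is brought to the form of a coefficient times [Qhat_p ^+ l]. *)
under [in RHS]eq_fun do under eq_bigr do rewrite [_ * Qhat_qinvp]mulrC exprMn mulrA.
rewrite (Qhat_lim_series_comp (fun l =>
  (\sum_(t : (size k).-tuple 'I_l.+1 | sumn [seq val i | i <- t] == l)
     \sum_(m <- undup (coarsenings (oslash [seq val i | i <- t] k))
             | preceq (oplus [seq val i | i <- t] k) m)
       Qhat_zetaSZ m) * Qhat_qinvp ^+ l)).
rewrite !rmorph_sum; apply: eq_bigr => l _.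
rewrite !rmorphM !rmorphXn rmorphM /= Qhat_qinvp_comp.
by rewrite exprMn mulrCA mulrC.
Qed.
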